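(* Let $\lambda>0$, $\xi>0$, and real velocities $v_2<v_1$ with either $v_2<0<v_1$ or $0<v_2<v_1$. Let $\{(\tilde X(t),V(t)),\,t\ge0\}$ be the extended telegraph process driven by geometric counting processes with parameter $\lambda$ and subject to Poissonian resets to the origin with rate $\xi$ (as described in the context), started at $\tilde X(0)=0$, $V(0)=v_j$. Then for all $t>0$ and $v_2t<x<v_1t$, for $j=1,2$, the (generalized) sub-densities satisfy $$ \begin{aligned} \tilde p_j(x,t\,|\,v_j)&=\frac{e^{-\xi t}\,\delta(x-v_jt)}{1+\lambda t}+\mathbb{1}_{\{v_2t<x<v_1t\}}\frac{e^{-\xi t}\lambda^2\tau^{2-j}(t-\tau)^{j-1}}{(v_1-v_2)(1+\lambda t)^2} +\mathrm{sgn}(v_j)\,\mathbb{1}_{\{0<\frac{x}{v_j}<t\}}\frac{\xi e^{-\xi x/v_j}}{v_j+\lambda x}\\ &\quad+\boldsymbol I(x,t)\Bigg[(-1)^{3-j}\frac{\xi(v_{3-j}+\lambda x)}{(v_1-v_2)^2}\,\Theta_\lambda^\xi(x,t)+(-1)^j\frac{\xi e^{\xi/\lambda}}{(v_1-v_2)^2}\Big(\frac{v_{3-j}(\lambda+\xi)}{\lambda}+x\xi\Big)\Gamma_\lambda^\xi(x,t)\Bigg], \end{aligned} $$ $$ \begin{aligned} \tilde p_{3-j}(x,t\,|\,v_j)&=\mathbb{1}_{\{v_2t<x<v_1t\}}\frac{e^{-\xi t}\lambda\big[1+\lambda\tau^{j-1}(t-\tau)^{2-j}\big]}{(v_1-v_2)(1+\lambda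 t)^2} +\boldsymbol I(x,t)\Bigg[(-1)^j\frac{\xi(v_{3-j}+\lambda x)}{(v_1-v_2)^2}\,\Theta_\lambda^\xi(x,t)\\ &\quad+(-1)^{3-j}\frac{\xi e^{\xi/\lambda}}{(v_1-v_2)^2}\Big(\frac{v_j(\lambda+\xi)}{\lambda}+x\xi+(-1)^j\frac{\xi(v_1-v_2)}{\lambda}\Big)\Gamma_\lambda^\xi(x,t)\Bigg]. \end{aligned} $$
   Context: Geometric counting process (GCP) with intensity $\lambda>0$: a counting process $\tilde N_\lambda$ with $\tilde N_\lambda(0)=0$ obtained as a Poisson process whose rate is random and exponentially distributed with mean $\lambda$; its increments satisfy $P\{\tilde N_\lambda(t+s)-\tilde N_\lambda(t)=k\}=\frac{1}{1+\lambda s}\big(\frac{\lambda s}{1+\lambda s}\big)^k$, $k\ge0$, and each inter-event time has marginal density $\lambda/(1+\lambda t)^2$, $t\ge0$. The process without resets $(X(t),V(t))$: a particle starts at $X(0)=0$ with velocity $V(0)=v_j\in\{v_1,v_2\}$ ($v_1,v_2\neq 0$, $v_2<v_1$) and moves on $\mathbb R$ with velocity alternating between $v_1$ and $v_2$, $X(t)=\int_0^tV(s)\,ds$; the numbers of periods spent with velocity $v_1$ and with velocity $v_2$ are governed by two independent GCPs each of intensity $\lambda$. Its generalized sub-densities $p_i(x,t\,|\,v_j)=P[X(t)\in dx,V(t)=v_i\,|\,X(0)=0,V(0)=v_j]/dx$ are, for $t>0$, $p_i(x,t|v_j)=\mathbb 1_{\{i=j\}}\frac{\delta(x-v_jt)}{1+\lambda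 t}+\mathbb 1_{\{v_2t<x<v_1t\}}\frac{\lambda c_{i,j}}{(v_1-v_2)(1+\lambda t)^2}$ with $c_{1,1}=\lambda\tau$, $c_{1,2}=1+\lambda\tau$, $c_{2,1}=1+\lambda(t-\tau)$, $c_{2,2}=\lambda(t-\tau)$, where $\tau=\tau(x,t)=\frac{x-v_2t}{v_1-v_2}$. The reset process $(\tilde X(t),V(t))$: same dynamics, but the particle is instantaneously reset to the origin at the epochs of an independent Poisson process of rate $\xi>0$, after which it restarts afresh with the initial velocity $v_j$. Its generalized sub-densities $\tilde p_i(x,t|v_j)\,dx=P[\tilde X(t)\in dx,V(t)=v_i\,|\,\tilde X(0)=0,V(0)=v_j]$ satisfy $\tilde p_i(x,t|v_j)=e^{-\xi t}p_i(x,t|v_j)+\xi\int_0^te^{-\xi s}p_i(x,s|v_j)\,ds$. Discrete components are written with the Dirac delta $\delta$. Notation: $M_x=\max\{x/v_1,x/v_2\}$, $m_{x,t}=\min\{x/v_2,t\}$; $\Gamma(a,z_0,z_1)=\int_{z_0}^{z_1}s^{a-1}e^{-s}ds$ (generalized incomplete gamma function); $\Gamma_\lambda^\xi(x,t)=\Gamma[0,(M_x+\frac1\lambda)\xi,(t+\frac1\lambda)\xi]$ if $v_2<0<v_1$ and $\Gamma[0,(\frac{x}{v_1}+\frac1\lambda)\xi,(m_{x,t}+\frac1\lambda)\xi]$ if $0<v_2<v_1$; $\boldsymbol I(x,t)=\mathbb 1_{\{\min\{v_2t,0\}<x<v_1t\}}$; $\Theta_\lambda^\xi(x,t)=\frac{e^{-\xi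 M_x}}{1+\lambda M_x}-\frac{e^{-\xi t}}{1+\lambda t}$ if $v_2<0<v_1$, and $\frac{e^{-\xi x/v_1}}{1+\lambda x/v_1}-\frac{e^{-\xi m_{x,t}}}{1+\lambda m_{x,t}}$ if $0<v_2<v_1$; $\mathrm{sgn}$ is the sign function; $\mathbb 1_A$ is the indicator of $A$. *)

(* Defs.v *)
From HB Require Import structures.
From mathcomp Require Import all_boot all_order all_algebra.
From mathcomp Require Import all_classical all_reals all_analysis.
Set Implicit Arguments. Unset Strict Implicit. Unset Printing Implicit Defensive.
Import Order.TTheory GRing.Theory Num.Theory.
Import numFieldNormedType.Exports.
Local Open Scope classical_set_scope.
Local Open Scope ring_scope.

Section GCPReset.
Variable R : realType.
Implicit Types (lam xi x t s a : R) (i j : nat).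

Definition vel v1 v2 k : R := if k == 1%N then v1 else v2.

Definition tau v1 v2 x t : R := (x - v2 * t) / (v1 - v2).

Definition cc lam v1 v2 i j x t : R :=
  let u := tau v1 v2 x t in
  if i == 1%N then (if j == 1%N then lam * u else 1 + lam * u)
  else (if j == 1%N then 1 + lam * (t - u) else lam * (t - u)).

(* absolutely continuous part of p_i(x,t|v_j) (process without resets) *)
Definition pac lam v1 v2 i j x t : R :=
  ((v2 * t < x) && (x < v1 * t))%:R *
  (lam * cc lam v1 v2 i j x t / ((v1 - v2) * (1 + lam * t) ^+ 2)).

(* sub-distribution P[X(t) in A, V(t) = v_i | V(0) = v_j] of the process without
   resets: the generalized sub-density p_i(.,t|v_j), i.e. the atom
   1_{i=j} delta(x - v_j t)/(1+lam t) plus the absolutely continuous part *)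
Definition pmeas lam v1 v2 i j t (A : set R) : \bar R :=
  (((i == j)%:R * ((1 + lam * t)^-1 * \1_A (vel v1 v2 j * t)))%:E
  + \int[lebesgue_measure]_(x in A) (pac lam v1 v2 i j x t)%:E)%E.

(* sub-distribution of the reset process, given by
   p~_i(x,t|v_j) = e^{-xi t} p_i(x,t|v_j) + xi \int_0^t e^{-xi s} p_i(x,s|v_j) ds *)
Definition ptilde lam xi v1 v2 i j t (A : set R) : \bar R :=
  ((expR (- xi * t))%:E * pmeas lam v1 v2 i j t A
  + xi%:E * \int[lebesgue_measure]_(s in (`[0%R, t]%classic : set R))
              ((expR (- xi * s))%:E * pmeas lam v1 v2 i j s A))%E.

Definition genGamma a z0 z1 : R :=
  Rintegral lebesgue_measure (`[z0, z1]%classic : set R) (fun s => s `^ (a - 1) * expR (- s)).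

Definition Mx v1 v2 x : R := Num.max (x / v1) (x / v2).
Definition mxt v2 x t : R := Num.min (x / v2) t.

Definition GammaLX lam xi v1 v2 x t : R :=
  if v2 < 0 then genGamma 0 ((Mx v1 v2 x + lam^-1) * xi) ((t + lam^-1) * xi)
  else genGamma 0 ((x / v1 + lam^-1) * xi) ((mxt v2 x t + lam^-1) * xi).

Definition ThetaLX lam xi v1 v2 x t : R :=
  if v2 < 0 then
    expR (- xi * Mx v1 v2 x) / (1 + lam * Mx v1 v2 x) - expR (- xi * t) / (1 + lam * t)
  else
    expR (- xi * (x / v1)) / (1 + lam * (x / v1))
    - expR (- xi * mxt v2 x t) / (1 + lam * mxt v2 x t).

Definition Ixt v1 v2 x t : R := ((Num.min (v2 * t) 0 < x) && (x < v1 * t))%:R.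

Definition dens_diag lam xi v1 v2 j x t : R :=
  let d := v1 - v2 in
  let vj := vel v1 v2 j in
  let vo := vel v1 v2 (3 - j)%N in
  let u := tau v1 v2 x t in
  ((v2 * t < x) && (x < v1 * t))%:R *
    (expR (- xi * t) * lam ^+ 2 * u ^+ (2 - j)%N * (t - u) ^+ (j - 1)%N
       / (d * (1 + lam * t) ^+ 2))
  + Num.sg vj * ((0 < x / vj) && (x / vj < t))%:R
      * (xi * expR (- xi * (x / vj)) / (vj + lam * x))
  + Ixt v1 v2 x t *
    ((-1) ^+ (3 - j)%N * (xi * (vo + lam * x) / d ^+ 2) * ThetaLX lam xi v1 v2 x t
     + (-1) ^+ j * (xi * expR (xi / lam) / d ^+ 2)
         * (vo * (lam + xi) / lam + x * xi) * GammaLX lam xi v1 v2 x t).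

Definition dens_off lam xi v1 v2 j x t : R :=
  let d := v1 - v2 in
  let vj := vel v1 v2 j in
  let vo := vel v1 v2 (3 - j)%N in
  let u := tau v1 v2 x t in
  ((v2 * t < x) && (x < v1 * t))%:R *
    (expR (- xi * t) * lam * (1 + lam * u ^+ (j - 1)%N * (t - u) ^+ (2 - j)%N)
       / (d * (1 + lam * t) ^+ 2))
  + Ixt v1 v2 x t *
    ((-1) ^+ j * (xi * (vo + lam * x) / d ^+ 2) * ThetaLX lam xi v1 v2 x t
     + (-1) ^+ (3 - j)%N * (xi * expR (xi / lam) / d ^+ 2)
         * (vj * (lam + xi) / lam + x * xi + (-1) ^+ j * (xi * d / lam))
         * GammaLX lam xi v1 v2 x t).

End GCPReset.

(* Main.v *)
(** Conditioning on the last reset gives [p~ = e^(-xi t) p + xi * int_0^t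
    e^(-xi s) p(., s) ds], and the two parts of [p] are integrated in time
    separately.  The moving atom [delta(x - v_j s)] becomes a density by the
    change of variables [x = v_j s].  For the absolutely continuous part,
    Tonelli lets us integrate in time for fixed [x]: for [v2 t <= x <= v1 t]
    the times [s < t] with [v2 s < x < v1 s] form an interval with right end
    [t], on which the coefficient [c_ij] is an affine function [a + b (1 + lam
    s)].  What remains are the integrals of [e^(-xi s) / (1 + lam s)], which
    is an incomplete gamma function by an affine substitution, and of [e^(-xi
    s) / (1 + lam s)^2], which reduces to the first since [(e^(-xi s) / (1 +
    lam s))' = - e^(-xi s) (lam / (1 + lam s)^2 + xi / (1 + lam s))]. *)
Require Import Defs.
From HB Require Import structures.
From mathcomp Require Import all_boot all_order all_algebra.
From mathcomp Require Import all_classical all_reals all_analysis.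
From mathcomp Require Import measurable_realfun.
From mathcomp Require Import ring lra.
Import Order.TTheory GRing.Theory Num.Theory.
Import numFieldNormedType.Exports.
Local Open Scope classical_set_scope.
Local Open Scope ring_scope.

(** * Measurability of inverses and of truth values *)

(* The identity [x^-1 = x * (x ^+ 2) `^ (-1)] also covers the junk value [0^-1 = 0]. *)
Lemma measurable_inv (R : realType) : measurable_fun [set: R] (@GRing.inv R).
Proof.
rewrite (_ : GRing.inv = fun x : R => x * (x ^+ 2) `^ (-1)); last first.
  apply/funext => x; rewrite powR_inv1 ?sqr_ge0//.
  have [->|x0] := eqVneq x 0; first by rewrite invr0 mul0r.
  by rewrite expr2 invfM mulrA divff// mul1r.
apply: measurable_funM => //.
apply: (measurableT_comp (measurable_powR _)).
exact: measurable_funX.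
Qed.

Lemma measurable_fun_natr_bool d (T : measurableType d) (R : realType)
    (b : T -> bool) :
  measurable_fun setT b -> measurable_fun setT (fun z => (b z)%:R : R).
Proof.
move=> mb; rewrite (_ : (fun z => (b z)%:R) = fun z => if b z then 1 else 0 : R).
  exact: measurable_fun_ifT.
by apply/funext => z; case: (b z).
Qed.

(** * Affine change of variables for the Lebesgue measure *)

Section affine_change_of_variables.
Context {R : realType}.
Local Notation mu := (@lebesgue_measure R).
Variables (c e : R).
Hypothesis c0 : c != 0.
Let phi (s : R) : measurableTypeR R := c * s + e.

Let mphi : measurable_fun [set: measurableTypeR R] phi.
Proof. by apply: measurable_funD => //; exact: measurable_funM. Qed.

(* Named explicitly: canonical inference cannot find [mphi]. *)
Let image_mu : {measure set (measurableTypeR R) -> \bar R} :=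
  measure_function_pushforward__canonical__measure_function_Measure mu mphi.

(** By uniqueness of the Lebesgue measure, half-open intervals suffice: the preimage of []a, b]] is
    an interval of length [(b - a) / |c|], with its ends swapped when [c < 0]. *)
Let lebesgue_measure_affine (A : set R) : measurable A ->
  mu A = mscale (NngNum (normr_ge0 c)) image_mu A.
Proof.
apply: lebesgue_measure_unique => _ [[a b]] _ <-.
rewrite [RHS](_ : _ = `|c|%:E * mu (phi @^-1` `]a, b]))%E//.
have [cp|cn|/eqP] := ltgtP c 0; last by rewrite (negbTE c0).
- rewrite (_ : phi @^-1` _ = `[(b - e) / c, (a - e) / c[%classic); last first.
    apply/seteqP; split => s /=; rewrite !in_itv/= /phi => /andP[h1 h2];
      rewrite ler_ndivrMr// ltr_ndivlMr// in h1 h2 *; apply/andP; split; nra.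
  rewrite !lebesgue_measure_itv/= !lte_fin ltr_ndivlMr// mulfVK//; last first.
  rewrite ltrD2r; case: ifPn => _; last by rewrite mule0.
  rewrite -!EFinB -EFinM; congr EFin; rewrite ltr0_norm//; field.
  by rewrite c0.
- rewrite (_ : phi @^-1` _ = `](a - e) / c, (b - e) / c]%classic); last first.
    apply/seteqP; split => s /=; rewrite !in_itv/= /phi => /andP[h1 h2];
      rewrite ler_pdivlMr// ltr_pdivrMr// in h1 h2 *; apply/andP; split; nra.
  rewrite !lebesgue_measure_itv/= !lte_fin ltr_pdivrMr// mulfVK//; last first.
  rewrite ltrD2r; case: ifPn => _; last by rewrite mule0.
  rewrite -!EFinB -EFinM; congr EFin; rewrite gtr0_norm//; field.
  by rewrite c0.
Qed.

(** Integrating over the whole line makes one formula serve both signs of [c]. It is applied with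
    slope [xi] to the gamma integral and with slope [v] to the moving atom. *)
Lemma ge0_integral_affine (g : R -> \bar R) :
  measurable_fun setT g -> (forall x, 0 <= g x)%E ->
  (\int[mu]_x g x = `|c|%:E * \int[mu]_s g (c * s + e)%R)%E.
Proof.
move=> mg g0.
transitivity (\int[mscale (NngNum (normr_ge0 c)) image_mu]_x g x)%E.
  by apply: eq_measure_integral => A mA _; exact: lebesgue_measure_affine.
rewrite ge0_integral_mscale//=; congr (_ * _)%E.
by rewrite ge0_integral_pushforward.
Qed.

End affine_change_of_variables.

(** * Measurability and sign of the absolutely continuous part *)

Section pac.
Context {R : realType} (lam v1 v2 : R).

(** Position and time are both functions of [z], so this covers joint measurability as well as
    measurability in one variable. *)
Lemma measurable_pac d (T : measurableType d) i j (f g : T -> R) :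
  measurable_fun setT f -> measurable_fun setT g ->
  measurable_fun setT (fun z => pac lam v1 v2 i j (f z) (g z)).
Proof.
move=> mf mg.
have mtau : measurable_fun setT (fun z => tau v1 v2 (f z) (g z)).
  by apply: measurable_funM => //; apply: measurable_funB => //;
     exact: measurable_funM.
apply: measurable_funM.
  apply: measurable_fun_natr_bool; apply: measurable_and;
  apply: measurable_fun_ltr => //; exact: measurable_funM.
apply: measurable_funM.
  apply: measurable_funM => //; rewrite /cc.
  case: (i == 1)%N; case: (j == 1)%N.
  - exact: measurable_funM.
  - by apply: measurable_funD => //; exact: measurable_funM.
  - by apply: measurable_funD => //; apply: measurable_funM => //;
      exact: measurable_funB.
  - by apply: measurable_funM => //; exact: measurable_funB.
apply: (measurableT_comp (@measurable_inv R)).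
apply: measurable_funM => //; apply: measurable_funX.
by apply: measurable_funD => //; apply: measurable_funM.
Qed.

(** On the support, [tau] is the time spent with velocity [v1] and lies between [0] and [t]. *)
Lemma pac_ge0 i j x t : 0 < lam -> v2 < v1 -> 0 <= t ->
  0 <= pac lam v1 v2 i j x t.
Proof.
move=> lam0 v21 t0; rewrite /pac.
have [/andP[x1 x2]|_] := boolP ((v2 * t < x) && (x < v1 * t)); last by rewrite mul0r.
have d0 : 0 < v1 - v2 by rewrite subr_gt0.
have u0 : 0 <= tau v1 v2 x t by apply: divr_ge0; lra.
have u1 : 0 <= t - tau v1 v2 x t.
  by rewrite subr_ge0 /tau ler_pdivrMr//; nra.
rewrite mul1r; apply: divr_ge0; last by apply: mulr_ge0; [lra|exact: sqr_ge0].
apply: mulr_ge0; first lra.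
by rewrite /cc; case: ifP => _; case: ifP => _; nra.
Qed.

End pac.

(** * Time integrals at a fixed position *)

Section time_integrals.
Context {R : realType} (lam xi : R).
Hypotheses (lam0 : 0 < lam) (xi0 : 0 < xi).
Local Notation mu := (@lebesgue_measure R).

Implicit Types s : R.

Let E s : R := expR (- xi * s).
Let u s : R := (1 + lam * s)^-1.

Let den_gt0 s : 0 <= s -> 0 < 1 + lam * s.
Proof. by move=> s0; rewrite ltr_wpDr ?ltr01// mulr_ge0// ltW. Qed.

Let is_derive_E s : is_derive s 1 E (- xi * E s).
Proof.
rewrite mulrC; apply: (@is_derive1_comp _ expR (fun s => - xi * s)).
by apply: is_derive_eq; rewrite /GRing.scale/= mulr1.
Qed.

Let is_derive_u s : 0 <= s -> is_derive s 1 u (- lam * u s ^+ 2).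
Proof.
move=> s0; have d0 := lt0r_neq0 (den_gt0 _ s0).
have D : is_derive s 1 (fun s => 1 + lam * s) lam.
  by apply: is_derive_eq; rewrite /GRing.scale/= add0r mul1r mulr1.
have := @is_deriveV _ (fun s => 1 + lam * s) s lam 1 d0 D.
move=> DV; apply: (is_derive_eq DV).
by rewrite /u -exprVn /GRing.scale/= mulNr mulrC mulNr.
Qed.

Let is_derive_Eu s : 0 <= s -> is_derive s 1 (fun s => E s * u s)
  (- (E s * (lam * u s ^+ 2 + xi * u s))).
Proof.
move=> s0; have Du := is_derive_u _ s0.
apply: is_derive_eq.
by rewrite /GRing.scale/= -/(E s); ring.
Qed.

Let derivable_weight s : 0 <= s ->
  derivable (fun s => E s * (lam * u s ^+ 2 + xi * u s)) s 1.
Proof.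
move=> s0; have DE := is_derive_E s; have Du := is_derive_u _ s0.
(* With [E] and [u] made arbitrary functions derivable at [s], only closure under the algebraic
   operations remains. *)
move: E u DE Du => E' u' DE Du.
exact: ex_derive.
Qed.

Variables (p q : R).
Hypotheses (p0 : 0 <= p) (pq : p <= q).

Let integrable_pq (f : R -> R) : (forall s, 0 <= s -> derivable f s 1) ->
  {within `[p, q], continuous f} /\
  mu.-integrable `[p, q] (EFin \o f).
Proof.
move=> df; suff cf : {within `[p, q], continuous f}.
  split=> //; apply: continuous_compact_integrable => //.
  exact: segment_compact.
apply: derivable_within_continuous => s; rewrite in_itv/= => /andP[ps _].
by apply: df; exact: le_trans ps.
Qed.

Let J := \int[mu]_(s in `[p, q]) (E s * u s).

Let integral_Eu : (\int[mu]_(s in `[p, q]) (E s * u s)%:E = J%:E)%E.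
Proof.
rewrite /J /Rintegral fineK//; apply: integrable_fin_num => //.
by apply: (integrable_pq (fun s => E s * u s) _).2 => s /is_derive_Eu[].
Qed.

Let Theta := E p / (1 + lam * p) - E q / (1 + lam * q).

Let integral_derive :
  (\int[mu]_(s in `[p, q]) (E s * (lam * u s ^+ 2 + xi * u s))%:E = Theta%:E)%E.
Proof.
(* The fundamental theorem of calculus is applied for [p < q]; for [p = q] both sides vanish. *)
have [pEq|] := eqVneq p q.
  by rewrite /Theta pEq subrr set_itv1 integral_set1.
rewrite neq_lt [q < p]ltNge pq orbF => pltq.
pose F s := - (E s * u s).
have DF s : 0 <= s -> is_derive s 1 F (E s * (lam * u s ^+ 2 + xi * u s)).
  move=> s0; have D := is_derive_Eu _ s0; apply: is_derive_eq.
  by rewrite opprK.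
have cF s : 0 <= s -> {for s, continuous F}.
  by move=> /DF[/derivable1_diffP/differentiable_continuous].
rewrite (@continuous_FTC2 _ _ F)//; first by congr EFin; rewrite /F /Theta opprK addrC.
- by apply: (integrable_pq _ _).1 => s /derivable_weight.
- split.
  + move=> s; rewrite in_itv/= => /andP[ps _].
    have s0 : 0 <= s by exact: le_trans p0 (ltW ps).
    by have [] := DF _ s0.
  + exact/cvg_at_right_filter/cF.
  + exact/cvg_at_left_filter/cF/(le_trans p0).
- move=> s; rewrite in_itv/= => /andP[ps _].
  have s0 : 0 <= s by exact: le_trans p0 (ltW ps).
  by rewrite derive1E; have [_ ->] := DF _ s0.
Qed.

(** The substitution [x = xi * s + xi / lam = (xi / lam) * (1 + lam * s)] turns
    [x^-1 * exp (- x) dx] into [lam * exp (- xi / lam) * E s * u s ds]. *)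
Let genGammaE :
  genGamma 0 ((p + lam^-1) * xi) ((q + lam^-1) * xi) = lam * expR (- (xi / lam)) * J.
Proof.
set z0 := (p + _) * xi; set z1 := (q + _) * xi.
pose G := (fun x : R => (x `^ (0 - 1) * expR (- x))%:E) \_ `[z0, z1].
have mG : measurable_fun setT G.
  apply/(measurable_restrictT _ _).1 => //; apply/measurable_EFinP.
  apply: measurable_funTS; apply: measurable_funM; first exact: measurable_powR.
  exact: (measurableT_comp (@measurable_expR R)).
have G0 x : (0 <= G x)%E.
  rewrite /G patchE; case: ifP => // _.
  by rewrite lee_fin mulr_ge0 ?powR_ge0 ?expR_ge0.
rewrite /genGamma /Rintegral integral_mkcond -/G.
rewrite (@ge0_integral_affine _ xi (xi / lam)) ?gt_eqF//.
rewrite [X in fine X](_ : _ = (lam * expR (- (xi / lam)))%:E * J%:E)%E//.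
rewrite -integral_Eu gtr0_norm// [in RHS]integral_mkcond.
rewrite -ge0_integralZl_EFin//; last 2 first.
- apply: (measurableT_comp mG).
  by apply: measurable_funD => //; exact: measurable_funM.
- exact: ltW.
rewrite -ge0_integralZl_EFin//; last 3 first.
- move=> s _; rewrite patchE; case: ifPn => // /[!inE]/=.
  rewrite in_itv/= => /andP[ps _]; rewrite lee_fin mulr_ge0 ?expR_ge0//.
  by rewrite invr_ge0 ltW// den_gt0// (le_trans p0).
- apply/(measurable_restrictT _ _).1 => //; apply: (measurable_int mu).
  by apply: (integrable_pq (fun s => E s * u s) _).2 => s /is_derive_Eu[].
- by rewrite mulr_ge0 ?expR_ge0// ltW.
apply: eq_integral => s _.
rewrite /G !patchE.
have -> : (xi * s + xi / lam \in `[z0, z1]%classic) = (s \in `[p, q]%classic).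
  rewrite !mem_setE !in_itv/= /z0 /z1.
  by rewrite [xi * s]mulrC [xi / lam]mulrC -mulrDl !ler_pM2r// !lerD2r.
case: ifPn => [|_]; last by rewrite !mule0.
rewrite inE/= in_itv/= => /andP[ps _].
have s0 : 0 <= s by exact: le_trans p0 ps.
have d0 := lt0r_neq0 (den_gt0 _ s0).
have x0 : 0 <= xi * s + xi / lam by rewrite addr_ge0 ?mulr_ge0 ?invr_ge0// ltW.
rewrite sub0r powR_inv1// -!EFinM; congr EFin.
rewrite opprD expRD /u /E mulNr.
have -> : xi * s + xi / lam = xi / lam * (1 + lam * s).
  by field; rewrite gt_eqF.
by field; rewrite d0 !gt_eqF.
Qed.

(** The fraction equals [a * (lam * u^2 + xi * u) + (lam * b - a * xi) * u]. Multiplied by [E], the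
    first term is an exact derivative and gives [Theta]; the second gives the gamma integral. *)
Lemma integral_exp_affine_frac (a b : R) :
  (\int[mu]_(s in `[p, q])
     (expR (- xi * s) * (lam * (a + b * (1 + lam * s)) / (1 + lam * s) ^+ 2))%:E =
   (a * Theta + (b - a * xi / lam) * expR (xi / lam) *
     genGamma 0 ((p + lam^-1) * xi) ((q + lam^-1) * xi))%:E)%E.
Proof.
rewrite genGammaE.
pose f2 s := E s * (lam * u s ^+ 2 + xi * u s).
transitivity (\int[mu]_(s in `[p, q])
  (a%:E * (f2 s)%:E + (lam * b - a * xi)%:E * (E s * u s)%:E))%E.
  apply: eq_integral => s; rewrite inE/= in_itv/= => /andP[ps _].
  have s0 : 0 <= s by exact: le_trans ps.
  have d0 := lt0r_neq0 (den_gt0 _ s0).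
  by rewrite -!EFinM -EFinD /f2 /u -/(E s); congr EFin; field.
have int1 := (integrable_pq _ derivable_weight).2.
have int2 : mu.-integrable `[p, q] (EFin \o (fun s => E s * u s)).
  by apply: (integrable_pq _ _).2 => s /is_derive_Eu[].
rewrite integralD//; [|exact: integrableZl|exact: integrableZl].
rewrite !integralZl// integral_derive integral_Eu -!EFinM -EFinD; congr EFin.
by rewrite expRN; field; rewrite !lt0r_neq0// expR_gt0.
Qed.

End time_integrals.

(** * Tonelli's theorem on a rectangle *)

Section tonelli_rectangle.
Context d1 d2 (T1 : measurableType d1) (T2 : measurableType d2) (R : realType).
Context (m1 : {sigma_finite_measure set T1 -> \bar R}).
Context (m2 : {sigma_finite_measure set T2 -> \bar R}).
Variables (D1 : set T1) (D2 : set T2) (f : T1 * T2 -> \bar R).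
Hypotheses (mD1 : measurable D1) (mD2 : measurable D2).
Hypotheses (mf : measurable_fun setT f).
Hypothesis f0 : forall x y, D1 x -> D2 y -> (0 <= f (x, y))%E.

(** The extension by zero is nonnegative on the whole product, although the sign of [f] is known
    only on the rectangle. *)
Let g := f \_ (D1 `*` D2).

Let mg : measurable_fun setT g.
Proof.
apply/(measurable_restrictT _ _).1; first exact: measurableX.
exact: measurable_funTS.
Qed.

Let g0 z : (0 <= g z)%E.
Proof.
rewrite /g patchE; case: ifPn => //; rewrite inE => -[].
by case: z => x y; exact: f0.
Qed.

Let gE1 : fubini_F m2 g = (fun x => \int[m2]_(y in D2) f (x, y))%E \_ D1.
Proof.
apply/funext => x; rewrite /fubini_F patchE; case: ifPn => [/set_mem xD1|xD1].
  rewrite [RHS]integral_mkcond; apply: eq_integral => y _; rewrite /g !patchE.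
  by congr (if _ then _ else _); apply/idP/idP; rewrite !inE => // -[].
rewrite integral0_eq// => y _; rewrite /g patchE ifF//.
by apply/negbTE; apply: contra xD1; rewrite !inE => -[].
Qed.

Let gE2 : fubini_G m1 g = (fun y => \int[m1]_(x in D1) f (x, y))%E \_ D2.
Proof.
apply/funext => y; rewrite /fubini_G patchE; case: ifPn => [/set_mem yD2|yD2].
  rewrite [RHS]integral_mkcond; apply: eq_integral => x _; rewrite /g !patchE.
  by congr (if _ then _ else _); apply/idP/idP; rewrite !inE => // -[].
rewrite integral0_eq// => x _; rewrite /g patchE ifF//.
by apply/negbTE; apply: contra yD2; rewrite !inE => -[].
Qed.

Lemma measurable_fun_integral_rect1 :
  measurable_fun D1 (fun x => \int[m2]_(y in D2) f (x, y))%E.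
Proof.
apply/(measurable_restrictT _ _).2 => //; rewrite -gE1.
exact: measurable_fun_fubini_tonelli_F.
Qed.

Lemma measurable_fun_integral_rect2 :
  measurable_fun D2 (fun y => \int[m1]_(x in D1) f (x, y))%E.
Proof.
apply/(measurable_restrictT _ _).2 => //; rewrite -gE2.
exact: measurable_fun_fubini_tonelli_G.
Qed.

Lemma fubini_tonelli_rect :
  (\int[m1]_(x in D1) \int[m2]_(y in D2) f (x, y) =
   \int[m2]_(y in D2) \int[m1]_(x in D1) f (x, y))%E.
Proof.
rewrite integral_mkcond -gE1 [RHS]integral_mkcond -gE2.
exact: fubini_tonelli.
Qed.

End tonelli_rectangle.

Section reset.
Context {R : realType} (lam xi v1 v2 : R).
Hypotheses (lam0 : 0 < lam) (xi0 : 0 < xi) (v21 : v2 < v1).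
Hypothesis v12 : (v2 < 0 < v1) \/ (0 < v2 < v1).
Local Notation mu := (@lebesgue_measure R).

(** * Reachable times and the time integral of the density *)

Section support.
Variables (x t : R).
Hypotheses (t0 : 0 < t) (x1 : v2 * t <= x) (x2 : x <= v1 * t).

(* [p] is the time from which [x] is reachable without reset; since [v2 * t <=
   x], [mxt] is [t] and the end point [x / v2] never enters when [0 < v2]. *)
Lemma support_time : exists p : R,
  [/\ 0 <= p <= t,
      forall s, 0 < s < t -> (v2 * s < x) && (x < v1 * s) = (p < s),
      Ixt v1 v2 x t = 1 \/ p = t /\ Ixt v1 v2 x t = 0,
      ThetaLX lam xi v1 v2 x t =
        expR (- xi * p) / (1 + lam * p) - expR (- xi * t) / (1 + lam * t) &
      GammaLX lam xi v1 v2 x t =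
        genGamma 0 ((p + lam^-1) * xi) ((t + lam^-1) * xi)].
Proof.
rewrite /ThetaLX /GammaLX /Ixt.
case: v12 => /andP[h1 h2].
- have v2n : v2 != 0 by rewrite lt_eqF.
  have v1n : v1 != 0 by rewrite gt_eqF.
  rewrite h1; exists (Mx v1 v2 x); rewrite /Mx; split=> //.
  + rewrite ge_max ler_pdivrMr// ler_ndivrMr// ![t * _]mulrC x1 x2 andbT.
    rewrite le_max; have [x0|x0] := leP 0 x; first by rewrite divr_ge0// ltW.
    by rewrite orbC mulr_le0// ?invr_le0 ltW.
  + move=> s /andP[s0 st]; rewrite gt_max andbC.
    by rewrite ltr_pdivrMr// ltr_ndivrMr// [s * _]mulrC [s * v2]mulrC.
  + have -> : Num.min (v2 * t) 0 = v2 * t.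
      by apply/min_idPl; rewrite mulr_le0_ge0 ?ltW.
    (* At either end of the range [Ixt] vanishes and [Mx] equals [t]: the second alternative. *)
    have [x1'|] := ltP (v2 * t) x; last first.
      move=> x1'; right; have -> : x = v2 * t by apply/eqP; rewrite eq_le x1 x1'.
      split=> //; rewrite [v2 * t / v2]mulrAC divff// mul1r; apply/max_idPr.
      by rewrite ler_pdivrMr// mulrC ler_pM2l// ltW.
    have [x2'|] := ltP x (v1 * t); first by left.
      move=> x2'; right; have -> : x = v1 * t by apply/eqP; rewrite eq_le x2 x2'.
      split=> //; rewrite [v1 * t / v1]mulrAC divff// mul1r; apply/max_idPl.
      by rewrite ler_ndivrMr// mulrC ler_pM2r// ltW.
- have v1gt : 0 < v1 by lra.
  have v1n : v1 != 0 by rewrite gt_eqF.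
  have x0 : 0 < x by apply: lt_le_trans x1; rewrite mulr_gt0.
  have mE : mxt v2 x t = t by apply/min_idPr; rewrite ler_pdivlMr// mulrC.
  rewrite (lt_gtF h1) mE; exists (x / v1); split=> //.
  + by rewrite (divr_ge0 (ltW x0) (ltW v1gt)) ler_pdivrMr// mulrC.
  + move=> s /andP[s0 st]; rewrite ltr_pdivrMr// [s * v1]mulrC.
    by have -> : v2 * s < x by apply: lt_le_trans x1; rewrite ltr_pM2l.
  (* Here the lower bound in [Ixt] is [0], which is below [x], so only the end [x = v1 * t] is
     exceptional. *)
  + have -> : Num.min (v2 * t) 0 = 0.
      by apply/min_idPr; rewrite mulr_ge0 ?ltW.
    rewrite x0 /=.
    have [x2'|] := ltP x (v1 * t); first by left.
      move=> x2'; right; have -> : x = v1 * t by apply/eqP; rewrite eq_le x2 x2'.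
      by split=> //; rewrite [v1 * t / v1]mulrAC divff// mul1r.
Qed.

(** For fixed [x] the coefficient [cc] is affine in time, with [a] and [b] depending on [x]. The
    density vanishes before [p] and after it has the form treated by [integral_exp_affine_frac]. *)
Lemma integral_pac_time i j (a b : R) :
  (forall s, cc lam v1 v2 i j x s = a + b * (1 + lam * s)) ->
  (\int[mu]_(s in `[0%R, t]) (expR (- xi * s) * pac lam v1 v2 i j x s)%:E =
   (Ixt v1 v2 x t / (v1 - v2) * (a * ThetaLX lam xi v1 v2 x t +
      (b - a * xi / lam) * expR (xi / lam) * GammaLX lam xi v1 v2 x t))%:E)%E.
Proof.
move=> ccE; have [p [/andP[p0 pt] pE I ThetaE GammaE]] := support_time.
pose h s := expR (- xi * s) * (lam * (a / (v1 - v2) + b / (v1 - v2) * (1 + lam * s))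
   / (1 + lam * s) ^+ 2).
have mE : measurable_fun setT (fun s : R => expR (- xi * s)).
  by apply: (measurableT_comp (@measurable_expR R)); exact: measurable_funM.
have mden : measurable_fun setT (fun s : R => 1 + lam * s).
  by apply: measurable_funD => //; exact: measurable_funM.
transitivity (\int[mu]_(s in `[p, t]) (h s)%:E)%E.
  (* The support is described for [0 < s < t] only, so the end points are removed from both
     integrals. *)
  rewrite [LHS]integral_itv_bndoo; last first.
    apply/measurable_EFinP; apply: measurable_funTS.
    by apply: measurable_funM => //; apply: measurable_pac.
  rewrite [RHS]integral_itv_bndoo; last first.
    apply/measurable_EFinP; apply: measurable_funTS.
    apply: measurable_funM => //; apply: measurable_funM.
      apply: measurable_funM => //; apply: measurable_funD => //.
      exact: measurable_funM.
    by apply: (measurableT_comp (@measurable_inv R)); exact: measurable_funX.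
  rewrite integral_mkcond [RHS]integral_mkcond; apply: eq_integral => s _.
  rewrite !patchE !mem_setE !in_itv/=.
  have [s0|s0] := ltP 0 s; last by rewrite ifF// ltNge (le_trans s0 p0).
  have [st|st] := ltP s t; last by rewrite /= andbF.
  rewrite andbT /= /pac pE ?s0//.
  have [ps|ps] := boolP (p < s); last by rewrite mul0r mulr0.
  have d0 : 1 + lam * s != 0 by rewrite gt_eqF// ltr_wpDr// mulr_ge0 ?ltW.
  rewrite mul1r ccE /h; congr EFin; field.
  by rewrite d0 subr_eq0 gt_eqF.
rewrite integral_exp_affine_frac// -ThetaE -GammaE; congr EFin.
(* When [p = t] the time interval is a point, and the difference and the gamma integral vanish, in
   agreement with [Ixt = 0]. *)
case: I => [->|[pEt ->]]; first by field; rewrite ?subr_eq0 !gt_eqF.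
rewrite ThetaE GammaE pEt subrr /genGamma set_itv1 Rintegral_set1.
by rewrite !mulr0 addr0 !mul0r.
Qed.

End support.

(** * The moving atom as a density *)

Section atom.
Variables (v t : R).
Hypothesis v0 : v != 0.

Let atom_density x := Num.sg v * ((0 < x / v) && (x / v < t))%:R *
  (expR (- xi * (x / v)) / (v + lam * x)).

(** Since [sgn v / v = 1 / |v|], the sign in the density turns [1 / v] into the Jacobian factor of
    [x = v * s]. *)
Let sg_div x :
  Num.sg v / (v + lam * x) = (`|v| * (1 + lam * (x / v)))^-1.
Proof.
have -> : v + lam * x = v * (1 + lam * (x / v)) by field.
rewrite (invfM v) (invfM `|v|) (mulrA (Num.sg v)); congr (_ * _).
have [vn|vp|/eqP] := ltgtP v 0; last by rewrite (negbTE v0).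
  by rewrite ltr0_sg// ltr0_norm// invrN mulN1r.
by rewrite gtr0_sg// gtr0_norm// mul1r.
Qed.

Lemma measurable_atom_density : measurable_fun setT (fun x : R =>
  Num.sg v * ((0 < x / v) && (x / v < t))%:R *
  (expR (- xi * (x / v)) / (v + lam * x))).
Proof.
have mv : measurable_fun setT (fun x : R => x / v) by exact: measurable_funM.
apply: measurable_funM.
  apply: measurable_funM => //; apply: measurable_fun_natr_bool.
  by apply: measurable_and; apply: measurable_fun_ltr.
apply: measurable_funM.
  by apply: (measurableT_comp (@measurable_expR R)); exact: measurable_funM.
apply: (measurableT_comp (@measurable_inv R)).
by apply: measurable_funD => //; exact: measurable_funM.
Qed.

Lemma atom_density_ge0 x : 0 <= Num.sg v * ((0 < x / v) && (x / v < t))%:R *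
  (expR (- xi * (x / v)) / (v + lam * x)).
Proof.
rewrite [expR _ / _]mulrC mulrACA sg_div.
have [/andP[x0 _]|_] := boolP ((0 < x / v) && (x / v < t)); last by rewrite mul0r mulr0.
rewrite mul1r mulr_ge0 ?expR_ge0// invr_ge0 mulr_ge0//.
by rewrite addr_ge0// mulr_ge0// ltW.
Qed.

(** At time [s] the atom sits at [v * s], so [x = v * s] carries its weights to space. End points
    are dropped to match [0 < x / v < t], and the Jacobian [|v|] cancels by [sg_div]. *)
Lemma integral_atom (A : set R) : measurable A ->
  (\int[mu]_(s in `[0%R, t])
     (expR (- xi * s) * ((1 + lam * s)^-1 * \1_A (v * s)))%:E =
   \int[mu]_(x in A) (Num.sg v * ((0 < x / v) && (x / v < t))%:R *
      (expR (- xi * (x / v)) / (v + lam * x)))%:E)%E.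
Proof.
move=> mA.
have mE : measurable_fun setT (fun s : R => expR (- xi * s)).
  by apply: (measurableT_comp (@measurable_expR R)); exact: measurable_funM.
rewrite [LHS]integral_itv_bndoo; last first.
  apply/measurable_EFinP; apply: measurable_funTS.
  apply: measurable_funM => //; apply: measurable_funM.
    apply: (measurableT_comp (@measurable_inv R)).
    by apply: measurable_funD => //; exact: measurable_funM.
  apply: (measurableT_comp (measurable_indic mA)).
  exact: measurable_funM.
have mg : measurable_fun setT ((EFin \o atom_density) \_ A).
  apply/(measurable_restrictT _ _).1 => //; apply: measurable_funTS.
  by apply/measurable_EFinP; exact: measurable_atom_density.
have g0 x : (0 <= ((EFin \o atom_density) \_ A) x)%E.
  by rewrite patchE; case: ifP => // _; rewrite lee_fin atom_density_ge0.
rewrite [RHS]integral_mkcond (@ge0_integral_affine _ v 0)//.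
rewrite -ge0_integralZl_EFin//; last first.
  apply: (measurableT_comp mg).
  by apply: measurable_funD => //; exact: measurable_funM.
rewrite [LHS]integral_mkcond; apply: eq_integral => s _; rewrite !patchE addr0.
rewrite mem_setE in_itv/= indicE /atom_density.
rewrite [v * s]mulrC mulfK//.
case: (s * v \in A); last by rewrite mulr0 mulr0 mule0 if_same.
have [/andP[s0 st]|_] := boolP ((0 < s) && (s < t)); last by rewrite mulr0 mul0r mule0.
rewrite -EFinM; congr EFin; rewrite !mulr1.
have -> : Num.sg v * (expR (- xi * s) / (v + lam * (s * v))) =
  expR (- xi * s) * (Num.sg v / (v + lam * (s * v))) by rewrite mulrCA.
rewrite sg_div mulfK// invfM mulrCA [`|v| * _]mulrA divff ?normr_eq0// mul1r.
by rewrite mulrC.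
Qed.

End atom.

(** * Decomposition of the reset process *)

Section assembly.
Variables (i j : nat) (t : R) (A : set R).
Hypotheses (t0 : 0 < t) (mA : measurable A).
Hypothesis vj0 : vel v1 v2 j != 0.
Local Notation v := (vel v1 v2 j).
Local Notation atom_density x := (Num.sg v * ((0 < x / v) && (x / v < t))%:R *
      (expR (- xi * (x / v)) / (v + lam * x))).

Let mE : measurable_fun setT (fun s : R => expR (- xi * s)).
Proof.
by apply: (measurableT_comp (@measurable_expR R)); exact: measurable_funM.
Qed.

(** The current atom stays; past atoms and past densities become integrals over [A] by
    [integral_atom] and Tonelli. All terms are nonnegative, so sums and scalars pass through the
    integrals. *)
Lemma ptildeE : ptilde lam xi v1 v2 i j t A =
  (((i == j)%:R * (expR (- xi * t) / (1 + lam * t) * \1_A (v * t)))%:E +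
   \int[mu]_(x in A)
      ((expR (- xi * t) * pac lam v1 v2 i j x t)%:E +
       ((i == j)%:R * (xi * atom_density x))%:E +
       xi%:E * \int[mu]_(s in `[0%R, t]) (expR (- xi * s) * pac lam v1 v2 i j x s)%:E))%E.
Proof.
pose f (z : R * R) := (expR (- xi * z.1) * pac lam v1 v2 i j z.2 z.1)%:E.
have mf : measurable_fun setT f.
  apply/measurable_EFinP; apply: measurable_funM.
    exact: (measurableT_comp mE).
  by apply: measurable_pac.
have mI : measurable (`[0, t]%classic : set R) by [].
have f0 s x : `[0, t]%classic s -> A x -> (0 <= f (s, x))%E.
  rewrite /= in_itv/= => /andP[s0 _] _.
  by rewrite lee_fin mulr_ge0 ?expR_ge0// pac_ge0.
pose K x := (\int[mu]_(s in `[0%R, t]) f (s, x))%E.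
have mK : measurable_fun A K by apply: measurable_fun_integral_rect2.
have K0 x : A x -> (0 <= K x)%E by move=> Ax; apply: integral_ge0 => s sI; exact: f0.
have pac0 s : 0 <= s -> (0 <= \int[mu]_(x in A) (pac lam v1 v2 i j x s)%:E)%E.
  by move=> s0; apply: integral_ge0 => x _; rewrite lee_fin pac_ge0.
have mpac s : measurable_fun A (fun x => (pac lam v1 v2 i j x s)%:E).
  by apply/measurable_EFinP; apply: measurable_funTS; apply: measurable_pac.
have a0 s : 0 <= s -> 0 <= (i == j)%:R * ((1 + lam * s)^-1 * \1_A (v * s)).
  move=> s0; rewrite mulr_ge0// mulr_ge0// ?indicE// invr_ge0.
  by rewrite addr_ge0// mulr_ge0// ltW.
have mP : measurable_fun A (fun x => (expR (- xi * t) * pac lam v1 v2 i j x t)%:E).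
  apply/measurable_EFinP; apply: measurable_funM => //.
  by apply: measurable_funTS; apply: measurable_pac.
have P0 x : (0 <= (expR (- xi * t) * pac lam v1 v2 i j x t)%:E)%E.
  by rewrite lee_fin mulr_ge0 ?expR_ge0// pac_ge0// ltW.
have mq : measurable_fun A (fun x => (atom_density x)%:E).
  apply/measurable_EFinP; apply: measurable_funTS.
  exact: measurable_atom_density.
have mQ : measurable_fun A (fun x => ((i == j)%:R * (xi * atom_density x))%:E).
  apply/measurable_EFinP; do 2 apply: measurable_funM => //.
  exact/measurable_EFinP.
have Q0 x : (0 <= ((i == j)%:R * (xi * atom_density x))%:E)%E.
  rewrite lee_fin mulr_ge0//; apply: mulr_ge0; first exact: ltW.
  exact: atom_density_ge0.
have Zl s : 0 <= s -> (\int[mu]_(x in A) f (s, x) =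
    (expR (- xi * s))%:E * \int[mu]_(x in A) (pac lam v1 v2 i j x s)%:E)%E.
  move=> s0; rewrite -(ge0_integralZl_EFin mu mA _ (mpac s)) ?expR_ge0//.
  by move=> x _; rewrite lee_fin pac_ge0.
have integralR : (\int[mu]_(x in A) (xi%:E * K x) =
    xi%:E * \int[mu]_(s in `[0%R, t]) ((expR (- xi * s))%:E *
       \int[mu]_(x in A) (pac lam v1 v2 i j x s)%:E))%E.
  rewrite (@ge0_integralZl _ _ _ mu A mA K mK)//; last by rewrite lee_fin ltW.
  congr (_ * _)%E; rewrite -(@fubini_tonelli_rect _ _ _ _ _ mu mu _ _ f mI mA mf f0).
  apply: eq_integral => s'; rewrite inE/= in_itv/= => /andP[s0 _].
  exact: Zl.
have mF : measurable_fun `[0, t] (fun s => (expR (- xi * s))%:E *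
       \int[mu]_(x in A) (pac lam v1 v2 i j x s)%:E)%E.
  apply: (eq_measurable_fun (fun s => \int[mu]_(x in A) f (s, x))%E).
    by move=> s; rewrite inE/= in_itv/= => /andP[s0 _]; exact: Zl.
  by apply: measurable_fun_integral_rect1.
have integralQ : (\int[mu]_(x in A) ((i == j)%:R * (xi * atom_density x))%:E =
    xi%:E * \int[mu]_(s in `[0%R, t]) ((expR (- xi * s))%:E *
       ((i == j)%:R * ((1 + lam * s)^-1 * \1_A (v * s)))%:E))%E.
  (* Without an atom, for [i != j], both sides are zero. *)
  have [_|_] := eqVneq i j; last first.
    rewrite integral0_eq; last by move=> x _; rewrite mul0r.
    rewrite integral0_eq ?mule0//.
    by move=> s' _; rewrite mul0r mule0.
  under eq_integral do rewrite mul1r EFinM.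
  rewrite ge0_integralZl_EFin//; last 2 first.
  - by move=> x _; rewrite lee_fin; exact: atom_density_ge0.
  - exact: ltW.
  rewrite -integral_atom//; congr (_ * _)%E; apply: eq_integral => s' _.
  by rewrite mul1r -EFinM.
have ma : measurable_fun `[0, t] (fun s => (expR (- xi * s))%:E *
       ((i == j)%:R * ((1 + lam * s)^-1 * \1_A (v * s)))%:E)%E.
  apply: emeasurable_funM; apply/measurable_EFinP; apply: measurable_funTS => //.
  apply: measurable_funM => //; apply: measurable_funM.
    apply: (measurableT_comp (@measurable_inv R)).
    by apply: measurable_funD => //; exact: measurable_funM.
  apply: (measurableT_comp (measurable_indic mA)).
  exact: measurable_funM.
have I0 s : `[0, t]%classic s -> 0 <= s by rewrite /= in_itv/= => /andP[].
rewrite (ge0_integralD mu mA _ (emeasurable_funD mP mQ) _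
  (measurable_funeM xi%:E mK)); last 2 first.
- by move=> x _; rewrite adde_ge0.
- by move=> x Ax; rewrite mule_ge0 ?K0// lee_fin ltW.
rewrite (ge0_integralD mu mA _ mP _ mQ)// integralQ integralR.
(* Distributing the definition gives the same four terms: current atom, current density, past atoms,
   past densities. *)
rewrite /ptilde /pmeas ge0_muleDr ?lee_fin ?a0 ?pac0 ?ltW//.
rewrite -(Zl _ (ltW t0)) -[LHS]addeA; congr (_ + _)%E.
  by rewrite -EFinM mulrCA -[in RHS]mulrA.
rewrite -[RHS]addeA; congr (_ + _)%E; rewrite -[RHS]ge0_muleDr; last 2 first.
- apply: integral_ge0 => s' /I0 s'0.
  by rewrite mule_ge0 ?lee_fin ?expR_ge0 ?a0.
- apply: integral_ge0 => s' /I0 s'0.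
  by rewrite mule_ge0 ?lee_fin ?expR_ge0 ?pac0.
congr (_ * _)%E; rewrite -ge0_integralD//; last 2 first.
- by move=> s' /I0 s'0; rewrite mule_ge0 ?lee_fin ?expR_ge0 ?a0.
- by move=> s' /I0 s'0; rewrite mule_ge0 ?lee_fin ?expR_ge0 ?pac0.
apply: eq_integral => s' /[!inE] /I0 s'0.
by rewrite ge0_muleDr ?lee_fin ?a0 ?pac0.
Qed.

End assembly.

End reset.

(** * The explicit sub-densities *)

Theorem theorem1 (R : realType) (lam xi v1 v2 : R) (j : nat) (t : R) :
  0 < lam -> 0 < xi -> v2 < v1 ->
  ((v2 < 0 < v1) \/ (0 < v2 < v1)) ->
  (j = 1 \/ j = 2)%N ->
  0 < t ->
  forall A : set R, measurable A -> A `<=` `[v2 * t, v1 * t]%classic ->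
    ptilde lam xi v1 v2 j j t A =
      (((expR (- xi * t) / (1 + lam * t)) * \1_A (vel v1 v2 j * t))%:E
      + \int[lebesgue_measure]_(x in A) (dens_diag lam xi v1 v2 j x t)%:E)%E
    /\
    ptilde lam xi v1 v2 (3 - j)%N j t A =
      (\int[lebesgue_measure]_(x in A) (dens_off lam xi v1 v2 j x t)%:E)%E.
Proof.
move=> lam0 xi0 v21 v12 j12 t0 A mA AI.
have v10 : v1 != 0 by case: v12 => /andP[h1 h2]; rewrite gt_eqF// (lt_trans h1).
have v20 : v2 != 0 by case: v12 => /andP[h1 h2]; [rewrite lt_eqF|rewrite gt_eqF].
have d0 : v1 - v2 != 0 by rewrite subr_eq0 gt_eqF.
have n0 : lam != 0 by rewrite gt_eqF.
have e0 : 1 + lam * t != 0 by rewrite gt_eqF// addr_gt0// mulr_gt0.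
(* The closed interval contains the position of the atom, which is one of its ends. *)
have AI1 x : A x -> v2 * t <= x by move/AI; rewrite /= in_itv/= => /andP[].
have AI2 x : A x -> x <= v1 * t by move/AI; rewrite /= in_itv/= => /andP[].
case: j12 => ->; split.
- rewrite ptildeE// mul1r; congr (_ + _)%E; apply: eq_integral => x /[!inE] Ax.
  (* Writing [lam * s = (1 + lam * s) - 1] in [lam * tau] gives the numerator
     [(lam * x + v2) - v2 * (1 + lam * s)], hence [a] and [b]. *)
  rewrite (@integral_pac_time _ _ _ _ _ lam0 xi0 v21 v12 x t t0 (AI1 _ Ax) (AI2 _ Ax)
    _ _ ((lam * x + v2) / (v1 - v2)) (- v2 / (v1 - v2))); last first.
    by move=> s; rewrite /cc/= /tau; field.
  rewrite -EFinM -!EFinD /dens_diag; congr EFin; congr (_ + _ + _).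
  + by rewrite /pac /cc/=; field; rewrite ?d0 ?e0 ?n0.
  + by rewrite mul1r mulrCA !mulrA.
  + by rewrite /vel/=; field; rewrite ?d0 ?e0 ?n0.
- rewrite ptildeE// mul0r add0e; apply: eq_integral => x /[!inE] Ax.
  (* The numerator of [lam * (s - tau)] is [v1 * (1 + lam * s) - (lam * x + v1)]; adding [1] turns
     the last [v1] into [v2]. *)
  rewrite (@integral_pac_time _ _ _ _ _ lam0 xi0 v21 v12 x t t0 (AI1 _ Ax) (AI2 _ Ax)
    _ _ (- (lam * x + v2) / (v1 - v2)) (v1 / (v1 - v2))); last first.
    by move=> s; rewrite /cc/= /tau; field.
  rewrite mul0r adde0 -EFinM -EFinD /dens_off; congr EFin; congr (_ + _).
  + by rewrite /pac /cc/=; field; rewrite ?d0 ?e0 ?n0.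
  (* The extra term comes from [v1 + xi * v2 / lam = v1 * (lam + xi) / lam - xi * (v1 - v2) /
     lam]. *)
  + by rewrite /vel/=; field; rewrite ?d0 ?e0 ?n0.
- rewrite ptildeE// mul1r; congr (_ + _)%E; apply: eq_integral => x /[!inE] Ax.
  rewrite (@integral_pac_time _ _ _ _ _ lam0 xi0 v21 v12 x t t0 (AI1 _ Ax) (AI2 _ Ax)
    _ _ (- (lam * x + v1) / (v1 - v2)) (v1 / (v1 - v2))); last first.
    by move=> s; rewrite /cc/= /tau; field.
  rewrite -EFinM -!EFinD /dens_diag; congr EFin; congr (_ + _ + _).
  + by rewrite /pac /cc/=; field; rewrite ?d0 ?e0 ?n0.
  + by rewrite mul1r mulrCA !mulrA.
  + by rewrite /vel/=; field; rewrite ?d0 ?e0 ?n0.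
- rewrite ptildeE// mul0r add0e; apply: eq_integral => x /[!inE] Ax.
  (* Adding [1] to [lam * tau] turns the [v2] in [a] into [v1]. *)
  rewrite (@integral_pac_time _ _ _ _ _ lam0 xi0 v21 v12 x t t0 (AI1 _ Ax) (AI2 _ Ax)
    _ _ ((lam * x + v1) / (v1 - v2)) (- v2 / (v1 - v2))); last first.
    by move=> s; rewrite /cc/= /tau; field.
  rewrite mul0r adde0 -EFinM -EFinD /dens_off; congr EFin; congr (_ + _).
  + by rewrite /pac /cc/=; field; rewrite ?d0 ?e0 ?n0.
  + by rewrite /vel/=; field; rewrite ?d0 ?e0 ?n0.
Qed.
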